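(* Let $m,k\ge1$ be integers and let $H:=\langle (B,I),(I,C)\rangle\subset G_{\Gamma_{m,k}}$. Then $$H\cong\mathbb Z_{k+1}\times\mathbb Z_{m+1},$$ $H$ is a normal subgroup of index $2$ in $G_{\Gamma_{m,k}}$, and conjugation by $(A,A)$ acts on $H$ by inversion on each factor. Consequently, $$G_{\Gamma_{m,k}}\cong(\mathbb Z_{k+1}\times\mathbb Z_{m+1})\rtimes\mathbb Z_2,$$ where the nontrivial element of $\mathbb Z_2$ acts by $(j,\ell)\mapsto(-j,-\ell)$. In particular, $$|G_{\Gamma_{m,k}}|=2(m+1)(k+1).$$ Moreover, every element of $G_{\Gamma_{m,k}}$ admits a unique expression of the form $$(A,A)^i(B,I)^j(I,C)^\ell,\qquad i\in\{0,1\},\quad 0\le j\le k,\quad 0\le\ell\le m.$$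
   Context: Put $\beta=\pi/(m+1)$, $\theta=\pi/(k+1)$, let $e_1,\dots,e_4$ be the standard orthonormal basis of $\mathbb R^4$, and set $P_1=e_4$, $P_2=(\sin\beta)e_3+(\cos\beta)e_4$, $Q_1=e_2$, $Q_2=(\sin\theta)e_1+(\cos\theta)e_2$ in the unit sphere $\mathbb S^3$. $\Gamma_{m,k}$ is the geodesic quadrilateral $P_1\to Q_1\to P_2\to Q_2\to P_1$ whose edges are the minimizing geodesic arcs, and $\gamma_1,\gamma_2,\gamma_3,\gamma_4$ are the great circles containing the edges $P_1Q_1$, $Q_1P_2$, $P_2Q_2$, $Q_2P_1$ respectively. For a great circle $\gamma=\Pi_\gamma\cap\mathbb S^3$, with $\Pi_\gamma$ a $2$-plane of $\mathbb R^4$, the geodesic reflection is $r_\gamma(x)=2\operatorname{proj}_{\Pi_\gamma}(x)-x$ (orthogonal projection), regarded as an element of $O(4)$. $G_{\Gamma_{m,k}}=\langle r_{\gamma_1},r_{\gamma_2},r_{\gamma_3},r_{\gamma_4}\rangle$. For $X,Y\in O(2)$, $(X,Y):=X\oplus Y\in O(4)$ is the block-diagonal map acting by $X$ on the coordinates $(x_1,x_2)$ and by $Y$ on $(x_3,x_4)$. $I$ is the $2\times2$ identity, and $$A=\begin{pmatrix}-1&0\\0&1\end{pmatrix},\quad B=\begin{pmatrix}\cos2\theta&-\sin2\theta\\ \sin2\theta&\cos2\theta\end{pmatrix},\quad C=\begin{pmatrix}\cos2\beta&-\sin2\beta\\ \sin2\beta&\cos2\beta\end{pmatrix}.$$ $\mathbb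 Z_n$ denotes the cyclic group of order $n$. *)

(* Defs.v *)
From HB Require Import structures.
From mathcomp Require Import all_boot all_order all_fingroup all_algebra.
From mathcomp Require Import all_classical all_reals all_analysis.
Set Implicit Arguments.
Unset Strict Implicit.
Unset Printing Implicit Defensive.
Import Order.TTheory GRing.Theory Num.Theory.
Local Open Scope classical_set_scope.
Local Open Scope ring_scope.

Definition is_subgroup (gT : groupType) (K : set gT) : Prop :=
  K 1%g /\ forall x y, K x -> K y -> K (x * y^-1)%g.

Definition subgroup_generated (gT : groupType) (S : set gT) : set gT :=
  smallest (@is_subgroup gT) S.

Definition is_normal (gT : groupType) (H G : set gT) : Prop :=
  [/\ is_subgroup H, H `<=` G &
      forall g h, G g -> H h -> H (g * h * g^-1)%g].

Definition left_cosets (gT : groupType) (H G : set gT) : set (set gT) :=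
  [set [set (g * h)%g | h in H] | g in G].

Definition has_index (gT : groupType) (H G : set gT) (n : nat) : Prop :=
  (left_cosets H G #= `I_n)%card.

Definition isomorphic_to (gT : groupType) (K : set gT) (fT : groupType) : Prop :=
  exists f : {multiplicative fT -> gT}, injective f /\ range f = K.

Definition orthogonalmx (R : realType) (n : nat) : pred 'M[R]_n :=
  [pred M | M *m M^T == 1%:M].

Record orthogonal_group (R : realType) (n : nat) := Orthogonal {
  ovalmx :> 'M[R]_n;
  _ : orthogonalmx ovalmx
}.
HB.instance Definition _ (R : realType) n := [isSub for @ovalmx R n].
HB.instance Definition _ (R : realType) n := [Choice of orthogonal_group R n by <:].

Section OrthogonalGroup.
Variables (R : realType) (n : nat).
Implicit Types M N : orthogonal_group R n.

Lemma orthogonal_mulmxT M : M *m M^T = 1%:M.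
Proof. by apply/eqP; case: M. Qed.

Lemma orthogonal_mulTmx M : M^T *m M = 1%:M.
Proof. exact/mulmx1C/orthogonal_mulmxT. Qed.

Lemma orthogonal1_subproof : orthogonalmx (1%:M : 'M[R]_n).
Proof. by rewrite /orthogonalmx /= trmx1 mulmx1. Qed.
Definition orthogonal1 := Orthogonal orthogonal1_subproof.

Lemma orthogonalM_subproof M N : orthogonalmx (M *m N).
Proof.
by rewrite /orthogonalmx /= trmx_mul mulmxA -(mulmxA (ovalmx M))
           orthogonal_mulmxT mulmx1 orthogonal_mulmxT.
Qed.
Definition orthogonalM M N := Orthogonal (orthogonalM_subproof M N).

Lemma orthogonalV_subproof M : orthogonalmx M^T.
Proof. by rewrite /orthogonalmx /= trmxK orthogonal_mulTmx. Qed.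
Definition orthogonalV M := Orthogonal (orthogonalV_subproof M).

Lemma orthogonal_mulgA : associative orthogonalM.
Proof. by move=> x y z; apply: val_inj; rewrite /= mulmxA. Qed.
Lemma orthogonal_mul1g : left_id orthogonal1 orthogonalM.
Proof. by move=> x; apply: val_inj; rewrite /= mul1mx. Qed.
Lemma orthogonal_mulg1 : right_id orthogonal1 orthogonalM.
Proof. by move=> x; apply: val_inj; rewrite /= mulmx1. Qed.
Lemma orthogonal_mulVg : left_inverse orthogonal1 orthogonalV orthogonalM.
Proof. by move=> x; apply: val_inj; rewrite /= orthogonal_mulTmx. Qed.
Lemma orthogonal_mulgV : right_inverse orthogonal1 orthogonalV orthogonalM.
Proof. by move=> x; apply: val_inj; rewrite /= orthogonal_mulmxT. Qed.

End OrthogonalGroup.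

HB.instance Definition _ (R : realType) n := isGroup.Build (orthogonal_group R n)
  (@orthogonal_mulgA R n) (@orthogonal_mul1g R n) (@orthogonal_mulg1 R n)
  (@orthogonal_mulVg R n) (@orthogonal_mulgV R n).

Section Sphere.
Variables (R : realType) (n : nat).
Implicit Types (p q x : 'rV[R]_n) (Pi : 'M[R]_n).

Definition dot p q : R := (p *m q^T) 0 0.

Definition sphere : set 'rV[R]_n := [set x | dot x x = 1].

(* The union of the images of the unit-speed geodesics
   t |-> cos t *: p + sin t *: v, 0 <= t <= d, that lead from p to q, where
   d is the spherical distance of p and q (for q distinct from p and - p
   there is exactly one such v). *)
Definition minimizing_arc p q : set 'rV[R]_n :=
  let d := acos (dot p q) in
  [set x | exists v t,
    [/\ sphere v, dot p v = 0, q = cos d *: p + sin d *: v,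
        0 <= t <= d & x = cos t *: p + sin t *: v]].

(* A linear subspace is given as the row space of a square matrix. *)
Definition plane Pi : Prop := \rank Pi = 2.

Definition great_circle Pi : set 'rV[R]_n :=
  [set x | (x <= Pi)%MS] `&` sphere.

Definition orthocomplement Pi : 'M[R]_n := orthomx idfun 1%:M Pi.

(* x *m orthoproj Pi is the orthogonal projection of the row vector x. *)
Definition orthoproj Pi : 'M[R]_n := proj_mx <<Pi>>%MS (orthocomplement Pi).

Lemma orthocomplementE Pi : orthocomplement Pi = kermx Pi^T.
Proof. by rewrite /orthocomplement /orthomx map_mx_id // mul1mx. Qed.

Lemma orthocomplementP p Pi : (p <= orthocomplement Pi)%MS = (p *m Pi^T == 0).
Proof. by rewrite orthocomplementE sub_kermx. Qed.

Lemma dot_self_eq0 p : dot p p = 0 -> p = 0.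
Proof.
rewrite /dot mxE => /eqP; rewrite psumr_eq0 => [/allP h|i _]; last first.
  by rewrite mxE -expr2 sqr_ge0.
apply/rowP => i; have := h i (mem_index_enum _).
by rewrite !mxE -expr2 sqrf_eq0 => /eqP.
Qed.

Lemma capmx_orthocomplement Pi : (<<Pi>> :&: orthocomplement Pi = 0)%MS.
Proof.
apply/eqP/rowV0P => v; rewrite sub_capmx genmxE orthocomplementP.
case/andP=> /submxP[u ->] /eqP h; apply: dot_self_eq0.
by rewrite /dot trmx_mul mulmxA h mul0mx mxE.
Qed.

Lemma addsmx_orthocomplement Pi :
  (1%:M <= <<Pi>> + orthocomplement Pi)%MS.
Proof.
rewrite sub1mx /row_full eqn_leq rank_leq_col /=.
rewrite (mxrank_disjoint_sum (capmx_orthocomplement Pi)) genmxE.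
by rewrite orthocomplementE mxrank_ker mxrank_tr subnKC ?rank_leq_row.
Qed.

Lemma orthoproj_idem Pi : orthoproj Pi *m orthoproj Pi = orthoproj Pi.
Proof. exact/proj_mx_proj/capmx_orthocomplement. Qed.

Lemma orthoproj_tr Pi : (orthoproj Pi)^T = orthoproj Pi.
Proof.
set Q := orthoproj Pi.
have h : Q *m (1%:M - Q)^T = 0.
  have sQ : (Q <= Pi)%MS.
    by rewrite -[X in (X <= _)%MS]mul1mx -(genmxE Pi) proj_mx_sub.
  have cQ : (1%:M - Q) *m Pi^T = 0.
    apply/sub_kermxP; rewrite -orthocomplementE -{1}[Q]mul1mx.
    exact: proj_mx_compl_sub (addsmx_orthocomplement Pi).
  case/submxP: sQ => D eD; rewrite {1}eD.
  by rewrite -mulmxA -[Pi *m _]trmxK trmx_mul trmxK cQ trmx0 mulmx0.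
have : Q = Q *m Q^T.
  by apply/eqP; rewrite -subr_eq0 -{1}[Q]mulmx1 -mulmxBr -trmx1 -linearB h.
by move=> e; rewrite {1}e trmx_mul trmxK -e.
Qed.

(* Orthogonal matrices act on column coordinate vectors, hence the transpose. *)
Definition reflection_mx Pi : 'M[R]_n := 2 *: (orthoproj Pi)^T - 1%:M.

Lemma reflection_mx_orthogonal Pi : orthogonalmx (reflection_mx Pi).
Proof.
rewrite /orthogonalmx /= /reflection_mx linearB linearZ /= trmxK trmx1.
rewrite orthoproj_tr mulmxBl mulmxBr mul1mx !mulmx1 -scalemxAl -scalemxAr.
rewrite orthoproj_idem scalerA opprB addrA.
rewrite addrAC -!scalerBl (_ : 2 * 2 - 2 - 2 = 0 :> R) ?scale0r ?add0r //.
by rewrite -natrM -!natrB.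
Qed.

Definition reflection Pi : orthogonal_group R n :=
  Orthogonal (reflection_mx_orthogonal Pi).

End Sphere.

(* The group generated by the geodesic reflections across the great circles
   that contain an edge of a geodesic polygon, given by the list of the ordered
   pairs of endpoints of its edges. *)
Definition reflection_group (R : realType) (n : nat)
    (edges : seq ('rV[R]_n * 'rV[R]_n)) : set (orthogonal_group R n) :=
  subgroup_generated [set r | exists e Pi,
    [/\ e \in edges, plane Pi, minimizing_arc e.1 e.2 `<=` great_circle Pi &
        r = reflection Pi]].

Section Quadrilateral.
Variable R : realType.

Definition beta (m : nat) : R := pi / m.+1%:R.
Definition theta (k : nat) : R := pi / k.+1%:R.

Definition e1 : 'rV[R]_4 := delta_mx 0 (inord 0).
Definition e2 : 'rV[R]_4 := delta_mx 0 (inord 1).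
Definition e3 : 'rV[R]_4 := delta_mx 0 (inord 2).
Definition e4 : 'rV[R]_4 := delta_mx 0 (inord 3).

Definition P1 : 'rV[R]_4 := e4.
Definition P2 (m : nat) : 'rV[R]_4 := sin (beta m) *: e3 + cos (beta m) *: e4.
Definition Q1 : 'rV[R]_4 := e2.
Definition Q2 (k : nat) : 'rV[R]_4 := sin (theta k) *: e1 + cos (theta k) *: e2.

Definition quadrilateral (m k : nat) : seq ('rV[R]_4 * 'rV[R]_4) :=
  [:: (P1, Q1); (Q1, P2 m); (P2 m, Q2 k); (Q2 k, P1)].

Definition mx2 (a b c d : R) : 'M[R]_2 :=
  \matrix_(i, j) if i == 0 then (if j == 0 then a else b)
                           else (if j == 0 then c else d).

Lemma mx2_orthogonal a b c d : a ^+ 2 + b ^+ 2 = 1 -> c ^+ 2 + d ^+ 2 = 1 ->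
  a * c + b * d = 0 -> orthogonalmx (mx2 a b c d).
Proof.
move=> ab cd acbd; apply/eqP/matrixP => i j; rewrite !mxE !big_ord_recl big_ord0.
rewrite !mxE addr0 /=; case: i j => [[|[|//]] ?] [[|[|//]] ?] //=.
by rewrite mulrC [d * b]mulrC.
Qed.

Lemma mxA_orthogonal : orthogonalmx (mx2 (-1) 0 0 1).
Proof.
by apply: mx2_orthogonal; rewrite ?sqrrN ?expr1n ?expr0n ?addr0 ?add0r ?mulr0 ?mul0r ?addr0.
Qed.
Definition mxA : orthogonal_group R 2 := Orthogonal mxA_orthogonal.

Lemma rotation_orthogonal t : orthogonalmx (mx2 (cos t) (- sin t) (sin t) (cos t)).
Proof.
apply: mx2_orthogonal; rewrite ?sqrrN ?cos2Dsin2 //.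
- by rewrite addrC cos2Dsin2.
- by rewrite mulNr mulrC subrr.
Qed.
Definition rotation t : orthogonal_group R 2 := Orthogonal (rotation_orthogonal t).

Definition mxB (k : nat) : orthogonal_group R 2 := rotation (2 * theta k).
Definition mxC (m : nat) : orthogonal_group R 2 := rotation (2 * beta m).

Lemma dsum_orthogonal (X Y : orthogonal_group R 2) :
  orthogonalmx (block_mx X 0 0 Y : 'M[R]_(2 + 2)).
Proof.
rewrite /orthogonalmx /= tr_block_mx mulmx_block !trmx0 !mulmx0 !mul0mx.
by rewrite !addr0 !add0r !orthogonal_mulmxT -scalar_mx_block.
Qed.
Definition dsum (X Y : orthogonal_group R 2) : orthogonal_group R 4 :=
  Orthogonal (dsum_orthogonal X Y).

End Quadrilateral.

(* The action of 'Z_2 on 'Z_p * 'Z_q (the latter with its additive group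
   structure) in which the nontrivial element acts by (j, l) |-> (- j, - l). *)
Section Inversion.
Variables p q : nat.

Definition inversion (x : 'Z_p * 'Z_q) (s : 'Z_2) : 'Z_p * 'Z_q :=
  if s == 0 then x else (- x.1, - x.2).

Lemma inversion0 : inversion^~ 1%g =1 id.
Proof. by []. Qed.

Lemma inversionM x : act_morph inversion x.
Proof.
case: x => x y s t; case: s t => [[|[|//]] ?] [[|[|//]] ?] //=.
by rewrite /inversion /= !opprK.
Qed.

Definition inversion_action := TotalAction inversion0 inversionM.

Lemma inversion_is_groupAction :
  is_groupAction [set: 'Z_p * 'Z_q]%G inversion_action.
Proof.
move=> s _; rewrite /= inE; apply/andP; split.
  by apply/fintype.subsetP => x _; rewrite inE.
apply/morphicP => -[x1 x2] [y1 y2] _ _; rewrite !actpermE /= /inversion.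
case: (s == 0) => //.
by congr pair; rewrite /= opprD.
Qed.

Definition inversion_groupAction := GroupAction inversion_is_groupAction.

End Inversion.

(* Main.v *)
Require Import Defs.
From HB Require Import structures.
From mathcomp Require Import all_boot all_order all_fingroup all_algebra.
From mathcomp Require Import all_classical all_reals all_analysis.
From mathcomp Require Import ring lra.
Set Implicit Arguments.
Unset Strict Implicit.
Unset Printing Implicit Defensive.
Local Open Scope classical_set_scope.
Local Open Scope group_scope.

(** Every edge of the quadrilateral joins a point of the circle x3 = x4 = 0 to a
point of the circle x1 = x2 = 0.  Its endpoints are therefore orthonormal, they
span the plane of its great circle, and the geodesic reflection splits along
R^4 = R^2 + R^2 into two line reflections of R^2.  In R^2 the reflection across
the line spanned by (sin t, cos t) is A times the rotation of angle 2t
([tr_mul_unit_vector]).  With a = (A, A), b = (B, I) and c = (I, C), the edges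
in cyclic order thus give a, ac, abc and ab ([edge_reflections]), and these four
elements generate the same group as a, b and c ([reflection_groupE]).

The rest is group theory.  The rotations b and c commute, they have finite
orders k+1 and m+1, and the involution a conjugates each of them to its inverse,
so (i, (j, l)) |-> a^i b^j c^l is a homomorphism from the semidirect product by
inversion, with image the group generated by a, b and c ([extensionM],
[range_extension]).  It is injective as soon as a^i b^j c^l = 1 forces i, j and l
to vanish in their ranges.  This can be read off the two diagonal blocks: the
trace separates A R, for R a rotation, from the identity, and a rotation of
angle 2 pi j / n with 0 < j < n is not the identity because sin (pi j / n) > 0
([reflection_rotation_free]).  All the claims are then facts about the
semidirect product, transported along this injection
([inversion_extension_structure]). *)

(** * Subgroups of a possibly infinite group *)

Section Subgroups.
Variable gT : groupType.
Implicit Types (x y : gT) (K S T : set gT).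

Lemma subgroupV K x : is_subgroup K -> K x -> K x^-1.
Proof. by move=> [K1 KF] Kx; rewrite -[x^-1]mul1g; apply: KF. Qed.

Lemma subgroupM K x y : is_subgroup K -> K x -> K y -> K (x * y).
Proof.
by move=> sK Kx Ky; rewrite -[y]invgK; apply: sK.2 => //; apply: subgroupV.
Qed.

Lemma subgroupX K x n : is_subgroup K -> K x -> K (x ^+ n).
Proof.
move=> sK Kx; elim: n => [|n IHn]; first exact: sK.1.
by rewrite expgS; apply: subgroupM.
Qed.

Lemma subgroup_generatedP S : is_subgroup (subgroup_generated S).
Proof.
split=> [K [[K1 _] _] //|x y Sx Sy K KS].
by apply: KS.1.2; [apply: Sx | apply: Sy].
Qed.

Lemma subgroup_generated_sub S K :
  is_subgroup K -> S `<=` K -> subgroup_generated S `<=` K.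
Proof. exact: smallest_sub. Qed.

Lemma sub_subgroup_generated S : S `<=` subgroup_generated S.
Proof. exact: sub_gen_smallest. Qed.

Lemma range_subgroup (fT : groupType) (f : fT -> gT) :
  {morph f : x y / x * y} -> is_subgroup (range f).
Proof.
move=> fM; have f1 : f 1 = 1 by apply: (mulgI (f 1)); rewrite -fM !mulg1.
split=> [|_ _ [x _ <-] [y _ <-]]; first by exists 1.
exists (x * y^-1) => //; rewrite fM; congr (_ * _).
by apply: (mulgI (f y)); rewrite -fM !mulgV f1.
Qed.

Lemma isomorphic_range (fT : groupType) (f : fT -> gT) :
  {morph f : x y / x * y} -> injective f -> isomorphic_to (range f) fT.
Proof.
move=> fM f_inj.
pose g : {multiplicative fT -> gT} := HB.pack f (isMultiplicative.Build _ _ f fM).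
by exists g.
Qed.

Lemma morph_inj (fT : groupType) (f : fT -> gT) :
  {morph f : x y / x * y} -> (forall u, f u = 1 -> u = 1) -> injective f.
Proof.
move=> fM f_ker u v fuv.
have f1 : f 1 = 1 by apply: (mulgI (f 1)); rewrite -fM !mulg1.
by apply: (mulIg v^-1); rewrite mulgV; apply: f_ker; rewrite fM fuv -fM mulgV.
Qed.

Lemma expg_modn x n d : x ^+ d = 1 -> x ^+ (n %% d) = x ^+ n.
Proof.
move=> xd.
by rewrite {2}(divn_eq n d) expgnDr mulnC expgnA xd expg1n mul1g.
Qed.

End Subgroups.

(** * Extension of a product of two cyclic groups by an inverting involution *)

Section InversionExtension.
Variables (gT : groupType) (a b c : gT) (p q : nat).
Hypotheses (a2 : a ^+ 2 = 1) (bcC : commute b c).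
Hypotheses (bJa : b ^ a = b^-1) (cJa : c ^ a = c^-1).
Hypotheses (b_exp : b ^+ p.+2 = 1) (c_exp : c ^+ q.+2 = 1).
Hypothesis abc_free : forall i j l, (i < 2)%N -> (j < p.+2)%N -> (l < q.+2)%N ->
  a ^+ i * b ^+ j * c ^+ l = 1 -> [/\ i = 0, j = 0 & l = 0]%N.

(* With the moduli in the form n.+2, the ring 'Z_n.+2 really has n.+2 elements
   and its values are literally ordinals below n.+2. *)
Let T : finGroupType := ('Z_p.+2 * 'Z_q.+2)%type.
Let E := sdprod_by (inversion_groupAction p.+2 q.+2).

Definition torus (x : T) : gT := b ^+ x.1 * c ^+ x.2.
Definition extension (u : E) : gT := a ^+ u.1 * torus u.2.

Lemma torusM : {morph torus : x y / x * y}.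
Proof.
move=> [x1 x2] [y1 y2]; rewrite /torus /= !expg_modn // !expgnDr !mulgA.
congr (_ * _); rewrite -!mulgA; congr (_ * _).
exact: (commuteX2 _ _ bcC).
Qed.

Lemma torus1 : torus 1 = 1. Proof. by rewrite /torus mulg1. Qed.

Lemma torusV x : torus x^-1 = (torus x)^-1.
Proof. by apply: (mulgI (torus x)); rewrite -torusM !mulgV torus1. Qed.

Lemma torusC x y : commute (torus x) (torus y).
Proof.
rewrite /commute -!torusM; congr torus.
by case: x y => [x1 x2] [y1 y2]; congr pair; apply: Zp_mulgC.
Qed.

Lemma torusJ x : torus x ^ a = (torus x)^-1.
Proof.
rewrite /torus conjMg !conjXg bJa cJa invgM -!expVgn.
by apply: commuteX2; apply/commute_sym/commuteV/commute_sym/commuteV.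
Qed.

(** The action of the semidirect product is conjugation by the powers of [a];
this is what makes [extension] a homomorphism. *)
Lemma torus_inversion x s : torus (inversion x s) = torus x ^ (a ^+ s).
Proof.
rewrite /inversion; case: s => [[|[|//]] ?] /=; first by rewrite conjg1.
by rewrite torusJ -torusV.
Qed.

Lemma extensionM : {morph extension : u v / u * v}.
Proof.
move=> u v; rewrite /extension /= torusM torus_inversion expg_modn // expgnDr.
by rewrite conjgE -!mulgA; congr (_ * _); rewrite !mulgA mulgV mul1g.
Qed.

Lemma extension_inj : injective extension.
Proof.
apply: morph_inj extensionM _ => u /=; rewrite /extension /torus mulgA.
move/(abc_free (ltn_ord _) (ltn_ord _) (ltn_ord _)) => [u1 u21 u22].
apply: val_inj; case: u => -[i [j l]] ? /= in u1 u21 u22 *.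
by congr (_, (_, _)); apply: val_inj.
Qed.

Lemma torus_inj : injective torus.
Proof.
apply: morph_inj torusM _ => -[j l]; rewrite /torus -[b ^+ _]mul1g.
move/(abc_free (i := 0) isT (ltn_ord _) (ltn_ord _)) => [_ j0 l0].
by congr pair; apply: val_inj.
Qed.

Fact ext_elt_subproof (ix : 'Z_2 * T) :
  ix \in finset.setX [set: 'Z_2]%G [set: T]%G.
Proof. by rewrite !inE. Qed.

Definition ext_elt i x : E :=
  SdPair (inversion_groupAction p.+2 q.+2) (ext_elt_subproof (i, x)).

Lemma extensionE i x : extension (ext_elt i x) = a ^+ i * torus x.
Proof. by []. Qed.

Lemma range_torus : subgroup_generated [set b; c] = range torus.
Proof.
apply/seteqP; split.
  apply: subgroup_generated_sub; first exact: range_subgroup torusM.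
  by move=> _ [->|->]; [exists (1, 0)%R | exists (0, 1)%R];
    rewrite // /torus /= ?mulg1 ?mul1g ?expg1.
have sH := subgroup_generatedP [set b; c].
move=> _ [x _ <-]; apply: (subgroupM sH); apply: (subgroupX _ sH);
  apply: sub_subgroup_generated; by [left | right].
Qed.

Lemma range_extension : subgroup_generated [set a; b; c] = range extension.
Proof.
apply/seteqP; split.
  apply: subgroup_generated_sub; first exact: range_subgroup extensionM.
  move=> _ [[->|->]|->];
    [exists (ext_elt 1%R (0, 0)%R) | exists (ext_elt 0%R (1, 0)%R)
    | exists (ext_elt 0%R (0, 1)%R)];
    by rewrite // extensionE /torus /= ?(mulg1, mul1g, expg1, expg0).
have sG := subgroup_generatedP [set a; b; c].
move=> _ [u _ <-]; apply: (subgroupM sG); last apply: (subgroupM sG);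
  apply: (subgroupX _ sG); apply: sub_subgroup_generated;
  by [left; left | left; right | right].
Qed.

(** An element of the extension conjugates by a power of [a], which acts by
inversion, and then by an element of the torus itself. *)
Lemma torus_normal : is_normal (range torus) (range extension).
Proof.
split=> [|_ [x _ <-]|_ _ [u _ <-] [x _ <-]].
- exact: range_subgroup torusM.
- by exists (ext_elt 0%R x); rewrite // extensionE mul1g.
have [v _ Ev] := subgroupV (range_subgroup extensionM) (imageT extension u).
exists (inversion x v.1 ^ v.2) => //.
rewrite -{1}[extension u]invgK -Ev -mulgA -conjgE /extension conjgM -torus_inversion.
by rewrite !conjgE !torusM torusV.
Qed.

(** Powers of [a] represent the cosets: the factor [torus u.2] of [extension u]
is absorbed by the subgroup. *)
Lemma torus_index : has_index (range torus) (range extension) 2.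
Proof.
pose coset i := [set a ^+ i * h | h in range torus].
rewrite /has_index.
have -> : left_cosets (range torus) (range extension) = coset @` `I_2.
  apply/seteqP; split=> [_ [_ [u _ <-] <-]|_ [i i2 <-]].
    exists (val u.1); first exact: ltn_ord.
    apply/seteqP; split=> _ [_ [x _ <-] <-].
      exists (torus (u.2^-1 * x)); first by exists (u.2^-1 * x).
      by rewrite torusM torusV mulgA /extension mulgK.
    exists (torus (u.2 * x)); first by exists (u.2 * x).
    by rewrite torusM mulgA.
  exists (a ^+ i) => //; exists (ext_elt (Ordinal i2) 1) => //.
  by rewrite extensionE torus1 mulg1.
apply: inj_card_eq => i j; rewrite !inE => i2 j2 eq_coset.
have : coset i (a ^+ i) by exists 1; [exists 1; rewrite // torus1 | rewrite mulg1].
rewrite eq_coset => -[_ [x _ <-]].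
rewrite -[LHS](extensionE (Ordinal j2)) -[RHS]mulg1 -torus1.
by rewrite -(extensionE (Ordinal i2)) => /extension_inj [].
Qed.

Lemma card_extension : (range extension #= `I_(2 * (p.+2 * q.+2)))%card.
Proof.
have -> : (2 * (p.+2 * q.+2) = #|{: E}|)%N.
  rewrite -cardsT.
  rewrite -(sdprod_card (sdprod_sdpair (inversion_groupAction p.+2 q.+2))).
  rewrite !card_injm ?injm_sdpair1 ?injm_sdpair2 //.
  by rewrite !cardsT card_prod !card_ord mulnC.
apply: card_eq_trans (inj_card_eq (in2W extension_inj)) _.
have /card_eq_trans : ([set: E] #= [set: 'I_#|{: E}|])%card.
  rewrite card_eq_sym -(_ : range (@enum_rank E) = setT).
    exact: inj_card_eq (in2W enum_rank_inj).
  by apply/seteqP; split=> // i _; exists (enum_val i); rewrite // enum_valK.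
by apply; rewrite card_eq_sym card_II.
Qed.

Lemma conj_inverts x y :
  subgroup_generated [set b] x -> subgroup_generated [set c] y ->
  a * (x * y) * a^-1 = x^-1 * y^-1.
Proof.
have sub s : [set b; c] s -> subgroup_generated [set s] `<=` range torus.
  move=> bcs; apply: subgroup_generated_sub (range_subgroup torusM) _ => _ ->.
  by rewrite -range_torus; apply: sub_subgroup_generated.
move=> /(sub b (or_introl erefl)) [x' _ <-] /(sub c (or_intror erefl)) [y' _ <-].
have aV : a^-1 = a by apply: (mulgI a); rewrite mulgV -expg2.
rewrite -torusM -{1}[a]invgK -mulgA -conjgE aV torusJ torusM invgM.
exact/commuteV/commute_sym/commuteV/torusC.
Qed.

Lemma unique_normal_form g : range extension g ->
  exists! ijl : 'I_2 * 'I_p.+2 * 'I_q.+2,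
    g = a ^+ ijl.1.1 * b ^+ ijl.1.2 * c ^+ ijl.2.
Proof.
move=> [u _ <-]; exists (u.1, u.2.1, u.2.2); split=> [|[[i j] l]] /=.
  by rewrite /extension mulgA.
rewrite -mulgA -[RHS](extensionE i (j, l)) => /extension_inj ->.
by [].
Qed.

Lemma inversion_extension_structure :
  let H := subgroup_generated [set b; c] in
  let G := subgroup_generated [set a; b; c] in
  [/\ H `<=` G, isomorphic_to H T, is_normal H G & has_index H G 2] /\
  [/\ isomorphic_to G E,
      (G #= `I_(2 * (p.+2 * q.+2)))%card &
      forall g, G g -> exists! ijl : 'I_2 * 'I_p.+2 * 'I_q.+2,
        g = a ^+ ijl.1.1 * b ^+ ijl.1.2 * c ^+ ijl.2].
Proof.
rewrite /= range_torus range_extension.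
split; split.
- by case: torus_normal.
- exact: isomorphic_range torusM torus_inj.
- exact: torus_normal.
- exact: torus_index.
- exact: isomorphic_range extensionM extension_inj.
- exact: card_extension.
- exact: unique_normal_form.
Qed.

End InversionExtension.

(** * Geodesic reflections across great circles through orthonormal points *)

Local Close Scope group_scope.
Local Open Scope ring_scope.
Import Order.TTheory GRing.Theory Num.Theory.

Section Reflections.
Variables (R : realType) (n : nat).
Implicit Types (p q x : 'rV[R]_n) (Pi : 'M[R]_n).

Definition orthonormal_pair p q := [/\ dot p p = 1, dot q q = 1 & dot p q = 0].

Lemma dotC p q : dot p q = dot q p.
Proof. by rewrite /dot -[q *m _]trmxK trmx_mul trmxK [RHS]mxE. Qed.

Lemma dotDl p q x : dot (p + q) x = dot p x + dot q x.
Proof. by rewrite /dot mulmxDl mxE. Qed.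

Lemma dotZl (s : R) p q : dot (s *: p) q = s * dot p q.
Proof. by rewrite /dot -scalemxAl mxE. Qed.

Lemma orthonormal_pairC p q : orthonormal_pair p q -> orthonormal_pair q p.
Proof. by case=> pp qq pq; split; rewrite // dotC. Qed.

Lemma mulmx_trE p q : p *m q^T = (dot p q)%:M.
Proof. exact: mx11_scalar. Qed.

Lemma span_gram p q : orthonormal_pair p q ->
  col_mx p q *m (col_mx p q)^T = 1%:M.
Proof.
move=> [pp qq pq]; rewrite tr_col_mx mul_col_row !mulmx_trE pp qq (dotC q p) pq.
by rewrite raddf0 -scalar_mx_block.
Qed.

Lemma span_rank p q : orthonormal_pair p q -> \rank (col_mx p q) = 2.
Proof.
move=> pq; apply/eqP; rewrite eqn_leq rank_leq_row /=.
by rewrite -[X in (X <= _)%N](mxrank1 R 2) -(span_gram pq) mxrankM_maxl.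
Qed.

(** Orthonormal points are at distance pi / 2, so that the only unit-speed
minimizing geodesic from [p] to [q] is t |-> cos t *: p + sin t *: q. *)
Lemma arc_sub_great_circle p q Pi : orthonormal_pair p q ->
  minimizing_arc p q `<=` great_circle Pi <-> (p <= Pi)%MS && (q <= Pi)%MS.
Proof.
move=> [pp qq pq]; rewrite /minimizing_arc pq acos0 cos_pihalf sin_pihalf.
have hpi : 0 <= pi / 2 :> R by rewrite divr_ge0 ?pi_ge0.
have in_arc t : 0 <= t <= pi / 2 ->
    exists v s, [/\ sphere v, dot p v = 0, q = 0 *: p + 1 *: v,
      0 <= s <= pi / 2 & cos t *: p + sin t *: q = cos s *: p + sin s *: v].
  by move=> t01; exists q, t; split; rewrite // scale0r add0r scale1r.
split=> [arc_Pi|/andP[pPi qPi] x [v [t [_ pv qv _ ->]]]].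
  apply/andP; split.
    have /arc_Pi[] := in_arc 0 (introT andP (conj (lexx _) hpi)).
    by rewrite cos0 sin0 scale1r scale0r addr0.
  have /arc_Pi[] := in_arc (pi / 2) (introT andP (conj hpi (lexx _))).
  by rewrite cos_pihalf sin_pihalf scale1r scale0r add0r.
(* The initial velocity [v] of a minimizing geodesic can only be [q]. *)
rewrite scale0r add0r scale1r in qv; rewrite -{}qv in pv *; split=> /=.
  by rewrite addmx_sub ?scalemx_sub.
rewrite /sphere /= dotDl !dotZl !(dotC _ (_ + _)) !dotDl !dotZl.
rewrite pp qq (dotC q) pq !mulr0 addr0 add0r !mulr1.
by rewrite -!expr2 cos2Dsin2.
Qed.

(** Write M for the right-hand side and Q for the projection.  Q is symmetric and
fixes [p] and [q], so Q M = M; the rows of Q are combinations of [p] and [q],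
which M fixes, so Q M = Q. *)
Lemma orthoproj_span p q Pi : orthonormal_pair p q -> plane Pi ->
  (p <= Pi)%MS -> (q <= Pi)%MS -> orthoproj Pi = p^T *m p + q^T *m q.
Proof.
move=> pq rPi pPi qPi; set Q := orthoproj Pi.
have fix_tr x : (x <= Pi)%MS -> Q *m x^T = x^T.
  move=> xPi; rewrite -{1}[Q]trmxK -trmx_mul orthoproj_tr; congr trmx.
  by rewrite proj_mx_id ?genmxE // capmx_orthocomplement.
have span_Pi : (col_mx p q :=: Pi)%MS.
  apply/eqmxP; rewrite -(geq_leqif (mxrank_leqif_eq _)) ?span_rank ?rPi //.
  by rewrite col_mx_sub pPi.
have /submxP[D QD] : (Q <= col_mx p q)%MS.
  by rewrite span_Pi -[Q]mul1mx -(genmxE Pi) proj_mx_sub.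
have <- : Q *m (p^T *m p + q^T *m q) = p^T *m p + q^T *m q.
  by rewrite mulmxDr !mulmxA !fix_tr.
by rewrite QD -mul_row_col -tr_col_mx mulmxA -(mulmxA D) span_gram // mulmx1.
Qed.

Lemma reflection_span p q Pi : orthonormal_pair p q -> plane Pi ->
  (p <= Pi)%MS -> (q <= Pi)%MS ->
  reflection Pi = 2 *: (p^T *m p + q^T *m q) - 1%:M :> 'M[R]_n.
Proof.
move=> pq rPi pPi qPi.
by rewrite /= /reflection_mx orthoproj_tr (orthoproj_span pq rPi pPi qPi).
Qed.

(** An edge with orthonormal endpoints lies on exactly one great circle, so it
contributes a single generator [r]. *)
Lemma edge_reflectionP p q (r s : orthogonal_group R n) : orthonormal_pair p q ->
  r = 2 *: (p^T *m p + q^T *m q) - 1%:M :> 'M[R]_n ->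
  (exists Pi, [/\ plane Pi, minimizing_arc p q `<=` great_circle Pi &
     s = reflection Pi]) <-> s = r.
Proof.
move=> pq rE; split=> [[Pi [rPi /(arc_sub_great_circle _ pq) /andP[pPi qPi] ->]]|->].
  by apply: val_inj; rewrite [RHS]rE -(reflection_span pq rPi pPi qPi).
pose Pi := <<col_mx p q>>%MS; have /andP[pPi qPi] : (p <= Pi)%MS && (q <= Pi)%MS.
  by rewrite !genmxE -col_mx_sub submx_refl.
have rPi : plane Pi by rewrite /plane genmxE span_rank.
exists Pi; split=> //; first by apply/(arc_sub_great_circle _ pq); rewrite pPi.
by apply: val_inj; rewrite [LHS]rE -(reflection_span pq rPi pPi qPi).
Qed.
End Reflections.

(** * Line reflections and rotations of the plane *)

Section PlaneIsometries.
Variable R : realType.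
Local Notation O2 := (orthogonal_group R 2).

Lemma mul_mx2 (a b c d a' b' c' d' : R) :
  mx2 a b c d *m mx2 a' b' c' d' =
  mx2 (a * a' + b * c') (a * b' + b * d') (c * a' + d * c') (c * b' + d * d').
Proof.
by apply/matrixP => i j; rewrite !mxE !big_ord_recl big_ord0 !mxE addr0;
  case: i j => [[|[|//]] ?] [[|[|//]] ?].
Qed.

Lemma mx2_1 : mx2 1 0 0 1 = 1%:M :> 'M[R]_2.
Proof.
by apply/matrixP => i j; rewrite !mxE; case: i j => [[|[|//]] ?] [[|[|//]] ?].
Qed.

Lemma rotationD s t : rotation (s + t) = (rotation s * rotation t)%g :> O2.
Proof.
apply: val_inj; rewrite /= mul_mx2 cosD sinD.
by congr mx2; ring.
Qed.

Lemma rotation0 : rotation 0 = 1%g :> O2.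
Proof. by apply: val_inj; rewrite /= cos0 sin0 oppr0 mx2_1. Qed.

Lemma rotationX t n : rotation (t *+ n) = (rotation t ^+ n)%g :> O2.
Proof.
elim: n => [|n IHn]; first by rewrite mulr0n rotation0.
by rewrite mulrS rotationD IHn expgS.
Qed.

Lemma mxA2 : (mxA R * mxA R)%g = 1%g.
Proof.
by apply: val_inj; rewrite /= mul_mx2 -mx2_1; congr mx2; ring.
Qed.

Lemma rotationJ t : (rotation t ^ mxA R = (rotation t)^-1)%g.
Proof.
have AV : (mxA R)^-1%g = mxA R by apply: (mulgI (mxA R)); rewrite mxA2 mulgV.
apply: (mulgI (rotation t)); rewrite mulgV conjgE AV.
apply: val_inj; rewrite /= !mul_mx2 -mx2_1.
by congr mx2; rewrite -?[RHS](cos2Dsin2 t); ring.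
Qed.

(** The trace is 0 on a reflection and 2 on the identity, which excludes i = 1.
For i = 0 the rotation has angle 2x with x = pi j / (n+1) in [0, pi[, and
cos (2x) = 1 - 2 sin^2 x equals 1 only if sin x = 0, that is only if x = 0. *)
Lemma reflection_rotation_free n i j : (i < 2)%N -> (j < n.+1)%N ->
  (mxA R ^+ i * rotation (2 * (pi / n.+1%:R)) ^+ j = 1)%g -> i = 0%N /\ j = 0%N.
Proof.
rewrite -rotationX; set t := pi / _; case: i => [|[|//]] _ jn.
  rewrite mul1g => /(congr1 val)/matrixP/(_ 0 0); rewrite !mxE /= => cos1.
  split=> //; apply/eqP/negP => /negP j0.
  have : 0 < sin (t *+ j).
    apply: sin_gt0_pi; rewrite -[_ *+ j]mulr_natr mulrAC.
    rewrite divr_gt0 ?mulr_gt0 ?pi_gt0 ?ltr0n ?lt0n //=.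
    by rewrite ltr_pdivrMr ?ltr0n // ltr_pM2l ?pi_gt0 // ltr_nat.
  move: cos1; rewrite -mulrnAr mulr_natl cos_mulr2n cos2sin2 => e.
  have : sin (t *+ j) ^+ 2 = 0 by lra.
  by move/eqP; rewrite sqrf_eq0 => /eqP ->; rewrite ltxx.
rewrite expg1 => /(congr1 val) /=; rewrite mul_mx2 -mx2_1 => /matrixP e.
have := e ord_max ord_max; have := e ord0 ord0; rewrite !mxE /= => ? ?.
by exfalso; lra.
Qed.

Lemma rotation_order n :
  (rotation (2 * (pi / n.+1%:R)) ^+ n.+1)%g = 1%g :> O2.
Proof.
rewrite -rotationX -mulrnAr -[_ *+ n.+1]mulr_natr divfK ?pnatr_eq0 //.
by apply: val_inj; rewrite /= mulr_natl cos2pi sin2pi oppr0 mx2_1.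
Qed.

(** The angle is measured from the second axis, as in the points P2 and Q2. *)
Definition unit_vector (t : R) : 'rV[R]_2 := \row_j if j == 0 then sin t else cos t.

Lemma unit_vector_norm t : unit_vector t *m (unit_vector t)^T = 1%:M.
Proof.
apply/matrixP => i j; rewrite !ord1 !mxE !big_ord_recl big_ord0 !mxE /= addr0.
by rewrite -!expr2 addrC cos2Dsin2.
Qed.

(** The left-hand side is the reflection across the line of [unit_vector t].  At
t = 0 it is [mxA], whose axis is the second coordinate axis; tilting the axis by
[t] composes the reflection with a rotation of angle 2t. *)
Lemma tr_mul_unit_vector t : 2 *: ((unit_vector t)^T *m unit_vector t) - 1%:M =
  (mxA R * rotation (2 * t))%g :> 'M[R]_2.
Proof.
rewrite /= mul_mx2 -mx2_1.
rewrite mulr_natl sin_mulr2n cos_mulr2n; apply/matrixP => i j.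
have e := sin2cos2 t.
by rewrite !mxE big_ord1 !mxE; case: i j => [[|[|//]] ?] [[|[|//]] ?] /=;
  rewrite -?expr2 ?e; ring.
Qed.

End PlaneIsometries.

(** * The reflection group of the quadrilateral *)

Section QuadrilateralReflections.
Variable R : realType.
Local Notation O2 := (orthogonal_group R 2).

Lemma dsumM (X Y X' Y' : O2) :
  (dsum X Y * dsum X' Y')%g = dsum (X * X')%g (Y * Y')%g.
Proof.
apply: val_inj; rewrite /= [LHS](@mulmx_block _ 2 2 2 2 2 2) !mulmx0 !mul0mx.
by rewrite !addr0 !add0r.
Qed.

Lemma dsum1 : dsum 1%g 1%g = 1%g :> orthogonal_group R 4.
Proof. by apply: val_inj; rewrite /= -scalar_mx_block. Qed.

Lemma dsum_inj (X Y X' Y' : O2) : dsum X Y = dsum X' Y' -> X = X' /\ Y = Y'.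
Proof.
by move=> /(congr1 val) /(@eq_block_mx _ 2 2 2 2)[? _ _ ?]; split; apply: val_inj.
Qed.

Lemma dsumX (X Y : O2) n : (dsum X Y ^+ n)%g = dsum (X ^+ n)%g (Y ^+ n)%g.
Proof.
elim: n => [|n IHn]; first by rewrite !expg0 dsum1.
by rewrite !expgS IHn dsumM.
Qed.

Lemma dsumV (X Y : O2) : ((dsum X Y)^-1)%g = dsum (X^-1)%g (Y^-1)%g.
Proof.
by apply: (mulgI (dsum X Y)); rewrite mulgV dsumM !mulgV dsum1.
Qed.

(** The points of the circles x3 = x4 = 0 and x1 = x2 = 0 on which the vertices of
the quadrilateral lie. *)
Definition upper (s : R) : 'rV[R]_(2 + 2) := row_mx (unit_vector s) (0 : 'rV_2).
Definition lower (t : R) : 'rV[R]_(2 + 2) := row_mx (0 : 'rV_2) (unit_vector t).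

Lemma upper_lower_orthonormal s t : orthonormal_pair (upper s) (lower t).
Proof.
split; rewrite /dot /upper /lower tr_row_mx mul_row_col ?unit_vector_norm.
- by rewrite mul0mx addr0 mxE.
- by rewrite mul0mx add0r mxE.
by rewrite trmx0 mulmx0 mul0mx addr0 mxE.
Qed.

Definition edge_reflection s t : orthogonal_group R 4 :=
  dsum (mxA R * rotation (2 * s))%g (mxA R * rotation (2 * t))%g.

Lemma edge_reflectionE s t :
  edge_reflection s t =
  2 *: ((upper s)^T *m upper s + (lower t)^T *m lower t) - 1%:M :> 'M[R]_(2 + 2).
Proof.
rewrite -[LHS]/(block_mx (mxA R * rotation (2 * s))%g 0
                         0 (mxA R * rotation (2 * t))%g).
rewrite -!tr_mul_unit_vector.
rewrite /upper /lower !tr_row_mx !mul_col_row !trmx0 !mulmx0 !mul0mx.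
rewrite add_block_mx !addr0 !add0r scale_block_mx !scaler0.
rewrite [X in _ = _ - X](scalar_mx_block 2 2).
by rewrite opp_block_mx add_block_mx !oppr0 !addr0.
Qed.

Lemma upperE s : upper s = sin s *: e1 R + cos s *: e2 R.
Proof.
apply/rowP => -[j j4]; rewrite !mxE /e1 /e2 /=.
rewrite -!(inj_eq val_inj) /= !inordK //.
case: splitP => -[j' j'2] /= ?; subst j; rewrite !mxE /=.
  by case: j' j'2 j4 => [|[|//]] ? ?; rewrite /= ?mulr1 ?mulr0 ?addr0 ?add0r.
by rewrite !mulr0 addr0.
Qed.

Lemma lowerE t : lower t = sin t *: e3 R + cos t *: e4 R.
Proof.
apply/rowP => -[j j4]; rewrite !mxE /e3 /e4 /=.
rewrite -!(inj_eq val_inj) /= !inordK //.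
case: splitP => -[j' j'2] /= ?; subst j; rewrite !mxE /=.
  by case: j' j'2 j4 => [|[|//]] ? ?; rewrite /= ?mulr0 ?addr0.
by case: j' j'2 j4 => [|[|//]] ? ?; rewrite /= ?mulr1 ?mulr0 ?addr0 ?add0r.
Qed.

Lemma upper0 : upper 0 = e2 R.
Proof. by rewrite upperE sin0 cos0 scale0r scale1r add0r. Qed.

Lemma lower0 : lower 0 = e4 R.
Proof. by rewrite lowerE sin0 cos0 scale0r scale1r add0r. Qed.

Lemma quadrilateralE m k : quadrilateral R m k =
  [:: (lower 0, upper 0); (upper 0, lower (beta R m));
      (lower (beta R m), upper (theta R k)); (upper (theta R k), lower 0)].
Proof. by rewrite upper0 lower0 upperE lowerE. Qed.

(** Two of the edges run from the lower circle to the upper one, the other two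
back; the formula for the reflection is symmetric in the endpoints. *)
Lemma edge_reflections m k :
  [set r | exists e Pi, [/\ e \in quadrilateral R m k, plane Pi,
     minimizing_arc e.1 e.2 `<=` great_circle Pi & r = reflection Pi]] =
  [set edge_reflection 0 0; edge_reflection 0 (beta R m);
       edge_reflection (theta R k) (beta R m); edge_reflection (theta R k) 0].
Proof.
have UL s t r : (exists Pi, [/\ plane Pi, minimizing_arc (upper s) (lower t) `<=`
    great_circle Pi & r = reflection Pi]) <-> r = edge_reflection s t.
  apply: edge_reflectionP (upper_lower_orthonormal s t) _.
  exact: edge_reflectionE.
have LU s t r : (exists Pi, [/\ plane Pi, minimizing_arc (lower t) (upper s) `<=`
    great_circle Pi & r = reflection Pi]) <-> r = edge_reflection s t.
  apply: edge_reflectionP (orthonormal_pairC (upper_lower_orthonormal s t)) _.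
  by rewrite [_^T *m _ + _]addrC; apply: edge_reflectionE.
rewrite quadrilateralE; apply/seteqP; split=> r.
  move=> [e [Pi [ein rPi arc_Pi rE]]]; move: ein arc_Pi; rewrite !inE.
  move=> /or4P[] /eqP -> /= arc_Pi;
    [left; left; left|left; left; right|left; right|right].
  - by apply/LU; exists Pi.
  - by apply/UL; exists Pi.
  - by apply/LU; exists Pi.
  - by apply/UL; exists Pi.
case=> [[[/LU|/UL]|/LU]|/UL] [Pi [rPi arc_Pi rE]].
- by exists (lower 0, upper 0), Pi; rewrite inE eqxx.
- by exists (upper 0, lower (beta R m)), Pi; rewrite !inE eqxx ?orbT.
- by exists (lower (beta R m), upper (theta R k)), Pi; rewrite !inE eqxx ?orbT.
- by exists (upper (theta R k), lower 0), Pi; rewrite !inE eqxx ?orbT.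
Qed.

Section Relations.
Variables m k : nat.
Let a : orthogonal_group R 4 := dsum (mxA R) (mxA R).
Let b : orthogonal_group R 4 := dsum (mxB R k) 1%g.
Let c : orthogonal_group R 4 := dsum 1%g (mxC R m).

(** Left multiplication by a^-1 recovers b from ab and c from ac. *)
Lemma reflection_groupE :
  reflection_group (quadrilateral R m k) = subgroup_generated [set a; b; c].
Proof.
rewrite /reflection_group edge_reflections.
have E00 : edge_reflection 0 0 = a.
  by rewrite /edge_reflection mulr0 rotation0 mulg1.
have E01 : edge_reflection 0 (beta R m) = (a * c)%g.
  by rewrite /edge_reflection mulr0 rotation0 dsumM.
have E11 : edge_reflection (theta R k) (beta R m) = (a * b * c)%g.
  by rewrite !dsumM !mulg1.
have E10 : edge_reflection (theta R k) 0 = (a * b)%g.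
  by rewrite dsumM mulg1 /edge_reflection mulr0 rotation0 mulg1.
rewrite E00 E01 E11 E10; apply/seteqP; split.
  set K := subgroup_generated [set a; b; c].
  have sK : is_subgroup K by exact: subgroup_generatedP.
  have [Ka Kb Kc] : [/\ K a, K b & K c].
    by split; apply: sub_subgroup_generated; [left; left|left; right|right].
  apply: subgroup_generated_sub => // r [[[->|->]|->]|->] //.
  - exact: (subgroupM sK).
  - by apply: (subgroupM sK) => //; exact: (subgroupM sK).
  - exact: (subgroupM sK).
set K := subgroup_generated [set a; a * c; a * b * c; a * b]%g.
have sK : is_subgroup K by exact: subgroup_generatedP.
have [Ka Kac Kab] : [/\ K a, K (a * c)%g & K (a * b)%g].
  by split; apply: sub_subgroup_generated;
    [left; left; left|left; left; right|right].
have KaV x : K (a * x)%g -> K x.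
  move=> Kax; rewrite -[x](mulKg a).
  by apply: (subgroupM sK) => //; apply: (subgroupV sK).
by apply: subgroup_generated_sub => // r [[->|->]|->] //; apply: KaV.
Qed.

Lemma dsum_conj_inverse (X Y : O2) :
  (X ^ mxA R = X^-1)%g -> (Y ^ mxA R = Y^-1)%g -> (dsum X Y ^ a = (dsum X Y)^-1)%g.
Proof. by move=> XJ YJ; rewrite conjgE !dsumV !dsumM -!conjgE XJ YJ. Qed.

Lemma dsum_relation_free i j l : (i < 2)%N -> (j < k.+1)%N -> (l < m.+1)%N ->
  (a ^+ i * b ^+ j * c ^+ l = 1)%g -> [/\ i = 0, j = 0 & l = 0]%N.
Proof.
move=> i2 jk lm; rewrite !dsumX !dsumM !expg1n !mulg1 -dsum1 => /dsum_inj[].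
move=> /(reflection_rotation_free i2 jk)[-> ->].
by move=> /(reflection_rotation_free (isT : (0 < 2)%N) lm)[_ ->].
Qed.

End Relations.
End QuadrilateralReflections.

Local Close Scope ring_scope.
Local Open Scope group_scope.

Theorem proposition2 (R : realType) (m k : nat) (m_ge1 : (1 <= m)%N)
    (k_ge1 : (1 <= k)%N) :
  let G : set (orthogonal_group R 4) := reflection_group (quadrilateral R m k) in
  let a : orthogonal_group R 4 := dsum (mxA R) (mxA R) in
  let b : orthogonal_group R 4 := dsum (mxB R k) 1 in
  let c : orthogonal_group R 4 := dsum 1 (mxC R m) in
  let H : set (orthogonal_group R 4) := subgroup_generated [set b; c] in
  (H `<=` G /\
   isomorphic_to H ('Z_k.+1 * 'Z_m.+1)%type) /\
  (is_normal H G /\ has_index H G 2) /\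
  (forall x y, subgroup_generated [set b] x -> subgroup_generated [set c] y ->
     a * (x * y) * a^-1 = x^-1 * y^-1) /\
  isomorphic_to G (sdprod_by (inversion_groupAction k.+1 m.+1)) /\
  (G #= `I_(2 * (m + 1) * (k + 1)))%card /\
  (forall g, G g ->
     exists! ijl : 'I_2 * 'I_k.+1 * 'I_m.+1,
       g = a ^+ ijl.1.1 * b ^+ ijl.1.2 * c ^+ ijl.2).
Proof.
case: m m_ge1 => // m' _; case: k k_ge1 => // k' _ G a b c H.
have a2 : a ^+ 2 = 1 by rewrite dsumX expg2 mxA2 dsum1.
have bcC : commute b c by rewrite /commute !dsumM !mulg1 !mul1g.
have conj1V : (1 : orthogonal_group R 2) ^ mxA R = 1^-1 by rewrite conj1g invg1.
have bJa : b ^ a = b^-1 by apply: dsum_conj_inverse (rotationJ _) conj1V.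
have cJa : c ^ a = c^-1 by apply: dsum_conj_inverse conj1V (rotationJ _).
have b_exp : b ^+ k'.+2 = 1 by rewrite dsumX expg1n rotation_order dsum1.
have c_exp : c ^+ m'.+2 = 1 by rewrite dsumX expg1n rotation_order dsum1.
have abc_free := @dsum_relation_free R m'.+1 k'.+1.
have [[HG isoH nHG iHG] [isoG cardG nfG]] :=
  inversion_extension_structure a2 bcC bJa cJa b_exp c_exp abc_free.
rewrite -reflection_groupE -/G in HG nHG iHG isoG cardG nfG.
split; first by split.
split; first by split.
split; first by move=> x y; apply: (conj_inverts a2 bcC bJa cJa b_exp c_exp).
split; first exact: isoG.
split; last exact: nfG.
by rewrite -mulnA [X in (2 * X)%N]mulnC !addn1.
Qed.
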